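(* The set $F=\{0,1\}\cup\{2^{-n}:n\in\mathbb{N}\}\subset\mathbb{R}$ satisfies $\dim_{\rm A}F=\dim_{\rm LA}F=0$, but $F$ is not equi-homogeneous.
   Context: $B_\delta(x)$ is the closed ball of radius $\delta$ and centre $x$ (in $\mathbb{R}$ with the usual metric), and $\mathcal{N}(A,\delta)$ is the minimum number of closed balls of radius $\delta$ with centres in $A$ whose union contains $A$. $F$ is equi-homogeneous if for all $\delta_0>0$ there exist $M\ge1$ and $c_1,c_2>0$ such that $\sup_{x\in F}\mathcal{N}(B_\delta(x)\cap F,\rho)\le M\inf_{x\in F}\mathcal{N}(B_{c_1\delta}(x)\cap F,c_2\rho)$ for all $0<\rho<\delta\le\delta_0$. The Assouad dimension $\dim_{\rm A}F$ is the infimum of all $s\in[0,\infty)$ such that for all $\delta_0>0$ there is $C>0$ with $\sup_{x\in F}\mathcal{N}(B_\delta(x)\cap F,\rho)\le C(\delta/\rho)^s$ for all $0<\rho<\delta\le\delta_0$. The lower Assouad dimension $\dim_{\rm LA}F$ is the supremum of all $s\in[0,\infty)$ such that for all $\delta_0>0$ there is $C>0$ with $\inf_{x\in F}\mathcal{N}(B_\delta(x)\cap F,\rho)\ge C(\delta/\rho)^s$ for all $0<\rho<\delta\le\delta_0$. *)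

(* Defs.v *)
From HB Require Import structures.
From mathcomp Require Import all_boot all_order all_algebra finmap.
From mathcomp Require Import all_classical all_reals all_analysis.
Import Order.TTheory GRing.Theory Num.Theory.
Import numFieldNormedType.Exports.

Set Implicit Arguments.
Unset Strict Implicit.
Unset Printing Implicit Defensive.

Local Open Scope classical_set_scope.
Local Open Scope ring_scope.

(* The value is +oo when no finite cover exists; otherwise the infimum of these
   natural numbers is attained. Balls of radius r are counted by their centres.
   closed_ball c r is [c - r, c + r] only for 0 < r. *)
Definition covering_number (R : realType) (A : set R) (r : R) : \bar R :=
  ereal_inf [set ((#|` s|)%fset%:R)%:E | s in
    [set s : {fset R} | [set` s] `<=` A /\
       A `<=` \bigcup_(c in [set` s]) closed_ball c r]].

Definition sup_covering (R : realType) (F : set R) (d r : R) : \bar R :=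
  ereal_sup [set covering_number (closed_ball x d `&` F) r | x in F].

Definition inf_covering (R : realType) (F : set R) (d r : R) : \bar R :=
  ereal_inf [set covering_number (closed_ball x d `&` F) r | x in F].

Definition equi_homogeneous (R : realType) (F : set R) : Prop :=
  forall d0 : R, 0 < d0 ->
  exists M c1 c2 : R, [/\ 1 <= M, 0 < c1, 0 < c2 &
    forall d r : R, 0 < r -> r < d -> d <= d0 ->
      (sup_covering F d r <= M%:E * inf_covering F (c1 * d) (c2 * r))%E].

Definition assouad_dim (R : realType) (F : set R) : \bar R :=
  ereal_inf [set s%:E | s in [set s : R | 0 <= s /\
    forall d0 : R, 0 < d0 -> exists2 C : R, 0 < C &
    forall d r : R, 0 < r -> r < d -> d <= d0 ->
      (sup_covering F d r <= (C * (d / r) `^ s)%:E)%E]].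

Definition lower_assouad_dim (R : realType) (F : set R) : \bar R :=
  ereal_sup [set s%:E | s in [set s : R | 0 <= s /\
    forall d0 : R, 0 < d0 -> exists2 C : R, 0 < C &
    forall d r : R, 0 < r -> r < d -> d <= d0 ->
      ((C * (d / r) `^ s)%:E <= inf_covering F d r)%E]].

Definition dyadic_set (R : realType) : set R :=
  [set 0; 1] `|` [set 2 ^- n | n in [set: nat]].

Arguments dyadic_set : clear implicits.

(* Main.v *)
(** Distinct points [y < x] of the set satisfy [2 y <= x], so every positive point
    [x] is isolated at all scales [d < x / 2], while a ball that is large compared
    with its centre contains, above scale [r], only about [log2 (d / r)] points.
    Logarithmic growth makes both dimensions vanish. Equi-homogeneity fails because
    the covering numbers of a ball around [0] are unbounded as [r] tends to [0],
    whereas those of a small ball around [1] equal [1]. *)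
Require Import Defs.
From HB Require Import structures.
From mathcomp Require Import all_boot all_order all_algebra finmap.
From mathcomp Require Import all_classical all_reals all_analysis.
From mathcomp Require Import lra.
Import Order.TTheory GRing.Theory Num.Theory.
Import numFieldNormedType.Exports.

Set Implicit Arguments.
Unset Strict Implicit.

Local Open Scope classical_set_scope.
Local Open Scope ring_scope.

(** * Closed balls and bounds on covering numbers *)

Lemma in_closed_ball (R : realType) (x d y : R) :
  0 < d -> closed_ball x d y <-> `|x - y| <= d.
Proof. by move=> d0; rewrite closed_ballE. Qed.

Lemma covering_number_le (R : realType) (A : set R) (r : R) (s : {fset R}) (k : nat) :
  [set` s] `<=` A -> A `<=` \bigcup_(c in [set` s]) closed_ball c r ->
  (#|` s| <= k)%N -> (covering_number A r <= k%:R%:E)%E.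
Proof.
move=> sA As sk; apply: (@le_trans _ _ (#|` s|%fset%:R)%:E).
  by apply: ereal_inf_lbound; exists s.
by rewrite lee_fin ler_nat.
Qed.

Lemma covering_number_ge (R : realType) (A : set R) (r : R) (k : nat) :
  (forall s : {fset R}, [set` s] `<=` A ->
    A `<=` \bigcup_(c in [set` s]) closed_ball c r -> (k <= #|` s|)%N) ->
  (k%:R%:E <= covering_number A r)%E.
Proof.
move=> H; apply: le_ereal_inf_tmp => _ [s [sA As] <-].
by rewrite lee_fin ler_nat; exact: H.
Qed.

Lemma covering_number_ge1 (R : realType) (A : set R) (r : R) :
  A !=set0 -> (1%:E <= covering_number A r)%E.
Proof.
move=> [a Aa]; apply: (@covering_number_ge _ _ _ 1%N) => s _ /(_ _ Aa) [c cs _].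
by rewrite cardfs_gt0; apply/fset0Pn; exists c.
Qed.

(** * Gaps in the dyadic set and covers of its balls *)

Lemma dyadic_setP (R : realType) (x : R) :
  dyadic_set R x <-> x = 0 \/ exists n, x = 2 ^- n.
Proof.
split.
  case=> [[->|->]|[n _ <-]]; [by left| |by right; exists n].
  by right; exists 0%N; rewrite expr0 invr1.
by case=> [->|[n ->]]; [left; left|right; exists n].
Qed.

Lemma exp2VS (R : realType) n : (2 : R) ^- n = 2 * 2 ^- n.+1.
Proof. by rewrite exprS invfM mulrA divff ?mul1r ?pnatr_eq0. Qed.

Lemma exp2V_gt0 (R : realType) n : 0 < (2 : R) ^- n.
Proof. by rewrite invr_gt0 exprn_gt0. Qed.

Lemma exp2V_le (R : realType) m n : ((2 : R) ^- m <= 2 ^- n) = (n <= m)%N.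
Proof. by rewrite lef_pV2 ?posrE ?exprn_gt0// ler_eXn2l// ltr1n. Qed.

Lemma exp2V_lt (R : realType) m n : ((2 : R) ^- m < 2 ^- n) = (n < m)%N.
Proof. by rewrite ltNge exp2V_le -ltnNge. Qed.

Lemma exp2V_small (R : realType) (e : R) : 0 < e -> exists n, 2 ^- n <= e.
Proof.
move=> e0; exists (Num.bound e^-1).
rewrite -[leRHS]invrK lef_pV2 ?posrE ?exprn_gt0 ?invr_gt0//.
have e1 : 0 <= e^-1 by rewrite invr_ge0 ltW.
apply: le_trans (ltW (archi_boundP e1)) _.
by rewrite -natrX ler_nat ltnW// ltn_expl.
Qed.

Lemma dyadic_set_ge0 (R : realType) (x : R) : dyadic_set R x -> 0 <= x.
Proof. by move=> /dyadic_setP [->|[n ->]]//; exact/ltW/exp2V_gt0. Qed.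

Lemma dyadic_set_gap (R : realType) (x y : R) :
  dyadic_set R x -> dyadic_set R y -> y < x -> 2 * y <= x.
Proof.
move=> Fx /dyadic_setP [->|[m ->]]; first by rewrite mulr0 => _; exact: dyadic_set_ge0.
case/dyadic_setP: Fx => [->|[n ->]]; first by rewrite ltNge ltW// exp2V_gt0.
rewrite exp2V_lt; case: m => [//|m].
by rewrite -exp2VS exp2V_le ltnS.
Qed.

Lemma dyadic_set_isolated (R : realType) (x y d : R) :
  dyadic_set R x -> dyadic_set R y -> 2 * d < x -> `|x - y| <= d -> y = x.
Proof.
move=> Fx Fy dx; rewrite ler_norml => /andP[xy1 xy2].
case: (ltgtP y x) => // [yx|xy].
  by have := dyadic_set_gap Fx Fy yx; lra.
by have := dyadic_set_gap Fy Fx xy; have := dyadic_set_ge0 Fx; lra.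
Qed.

Lemma covering_isolated (R : realType) (x d r : R) :
  dyadic_set R x -> 0 < d -> 0 < r -> 2 * d < x ->
  (covering_number (closed_ball x d `&` dyadic_set R) r <= 1%:E)%E.
Proof.
move=> Fx d0 r0 dx.
apply: (@covering_number_le _ _ _ [fset x]%fset 1); last by rewrite cardfs1.
- move=> y /=; rewrite inE => /eqP ->; split=> //.
  by apply/in_closed_ball => //; rewrite subrr normr0 ltW.
- move=> y [/(in_closed_ball _ _ d0) xy Fy]; exists x; first by rewrite /= inE.
  rewrite (dyadic_set_isolated Fx Fy dx xy).
  by apply/in_closed_ball => //; rewrite subrr normr0 ltW.
Qed.

(** The points above [r] in the ball are powers [2 ^- n] with [n] in an interval of [k] exponents;
    each serves as its own centre, and one further ball takes all points of [[0, r]]. *)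
Lemma covering_count (R : realType) (x d r : R) :
  dyadic_set R x -> 0 < r -> r < d -> exists k : nat,
  2 ^+ k <= 6 * (d / r) /\
  (covering_number (closed_ball x d `&` dyadic_set R) r <= k.+1%:R%:E)%E.
Proof.
move=> Fx r0 rd; have d0 := lt_trans r0 rd.
have t1 : 1 < d / r by rewrite ltr_pdivlMr// mul1r.
have [dx|xd] := ltP (2 * d) x.
  by exists 0%N; split; [rewrite expr0; lra|exact: covering_isolated].
(* Now [x <= 2 * d], so the ball reaches no further than [x + d <= 3 * d]. *)
set A := _ `&` _.
have AP (y : R) : A y -> dyadic_set R y /\ y <= 3 * d.
  by move=> [/(in_closed_ball _ _ d0)]; rewrite ler_norml => /andP[? ?] ?; split=> //; lra.
have ex_n1 := exp2V_small r0.
have d3 : 0 < 3 * d by lra.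
have ex_n0 := exp2V_small d3.
case: (ex_minnP ex_n1) => n1 n1r n1min.
case: (ex_minnP ex_n0) => n0 n0d n0min.
have n01 : (n0 <= n1)%N by apply: n0min; lra.
exists (n1 - n0)%N; split.
  (* If [n0 < n1], minimality of [n1] gives [r <= 2 ^- (n1 - 1)], whence
     [2 ^ k * r <= 2 * 2 ^- n0 <= 6 * d]. *)
  have [<-|n01'] := eqVneq n0 n1; first by rewrite subnn expr0; lra.
  have {n01'}n01' : (n0 < n1)%N by rewrite ltn_neqAle n01' n01.
  case: n1 n01 n01' n1r n1min => [//|n1 _ n01' _ n1min].
  have rn1 : r <= 2 ^- n1.
    by rewrite leNgt; apply/negP => /ltW/n1min; rewrite ltnn.
  rewrite subSn// exprS mulrA ler_pdivlMr//.
  apply: (@le_trans _ _ (2 * 2 ^+ (n1 - n0) * 2 ^- n1)).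
    by rewrite ler_wpM2l// mulr_ge0// exprn_ge0.
  rewrite -mulrA expfB_cond ?pnatr_eq0// mulrAC divff ?mul1r ?expf_neq0 ?pnatr_eq0//.
  lra.
(* Centres must lie in [A], hence the filter. *)
pose idx := [seq n <- iota n0 (n1 - n0) | `[< A (2 ^- n) >]].
pose pts := [seq (2 : R) ^- n | n <- idx].
have ptsA (y : R) : y \in pts -> A y.
  by move=> /mapP[n]; rewrite mem_filter => /andP[/asboolP An _] ->.
have size_pts : (size pts <= n1 - n0)%N.
  by rewrite size_map size_filter (leq_trans (count_size _ _))// size_iota.
have large (y : R) : A y -> r < y -> y \in pts.
  move=> Ay ry; have [/dyadic_setP [y0|[n yn]] y3] := AP _ Ay.
    by rewrite y0 ltNge ltW in ry.
  rewrite yn; apply: map_f; rewrite mem_filter mem_iota subnKC//.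
  rewrite -yn; apply/andP; split; first exact/asboolP.
  rewrite n0min -?yn//= ltnNge; apply/negP => n1n.
  have := exp2V_le R n n1; rewrite n1n -yn => yn1.
  by have := lt_le_trans ry (le_trans yn1 n1r); rewrite ltxx.
have self (y : R) : closed_ball y r y.
  by apply/in_closed_ball => //; rewrite subrr normr0 ltW.
(* Any point [z <= r] of [A] can be the further centre, as two points of [[0, r]] are at distance at
   most [r]. If there is none, [pts] alone suffices. *)
have [[z [Az zr]]|noz] := pselect (exists z : R, A z /\ z <= r).
  apply: (@covering_number_le _ _ _ [fset y in z :: pts]%fset).
  - by move=> y /=; rewrite !inE => /orP[/eqP ->|/ptsA].
  - move=> y Ay; have [yr|ry] := leP y r.
      exists z; first by rewrite /= !inE eqxx.
      apply/in_closed_ball => //.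
      have := dyadic_set_ge0 (AP _ Ay).1; have := dyadic_set_ge0 (AP _ Az).1.
      by rewrite ler_norml => *; apply/andP; split; lra.
    by exists y => //=; rewrite !inE large ?orbT.
  - by rewrite card_fseq (leq_trans (size_undup _))//= ltnS.
apply: (@covering_number_le _ _ _ [fset y in pts]%fset).
- by move=> y /=; rewrite !inE => /ptsA.
- move=> y Ay; exists y => //=; rewrite !inE large// ltNge.
  by apply/negP => yr; apply: noz; exists y.
- by rewrite card_fseq (leq_trans (size_undup _))// ltnW.
Qed.

(** * The two dimensions *)

Lemma assouad_dim_dyadic_set (R : realType) : assouad_dim (dyadic_set R) = 0%E.
Proof.
apply/eqP; rewrite eq_le; apply/andP; split; last first.
  by apply: le_ereal_inf_tmp => _ [s [s0 _] <-]; rewrite lee_fin.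
apply/lee_addgt0Pr => s s0; rewrite add0e.
apply: ereal_inf_lbound; exists s => //; split; first exact: ltW.
have sln2 : 0 < s * ln 2 by rewrite mulr_gt0// ln_gt0// ltr1n.
(* The summand [1] pays for the further ball, since [(d / r) ^ s >= 1]; the other one bounds [k]. *)
move=> d0 _; exists (1 + 6 `^ s / (s * ln 2)).
  by rewrite ltr_pwDl// divr_ge0 ?powR_ge0 ?ltW.
move=> d r r0 rd dd0; apply: ge_ereal_sup => _ [x Fx <-].
have [k [kt /le_trans]] := covering_count Fx r0 rd; apply.
have t1 : 1 < d / r by rewrite ltr_pdivlMr// mul1r.
have t6 : 0 < 6 * (d / r) by lra.
have ts1 : 1 <= (d / r) `^ s by rewrite -(powRr0 (d / r)) ler_powR// ltW.
rewrite lee_fin -natr1 addrC mulrDl mul1r lerD// mulrAC ler_pdivlMr//.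
rewrite -powRM//; last by lra.
(* Taking logarithms in [2 ^ k <= 6 d / r] and bounding [ln z < z] at [z = (6 d / r) ^ s]. *)
have z0 : 0 < (6 * (d / r)) `^ s by rewrite powR_gt0.
apply: le_trans (ltW (ln_sublinear z0)).
rewrite ln_powR mulrCA ler_pM2l// mulrC mulr_natr -lnXn// ler_ln// posrE.
exact: exprn_gt0.
Qed.

Lemma lower_assouad_dim_dyadic_set (R : realType) :
  lower_assouad_dim (dyadic_set R) = 0%E.
Proof.
have F1 : dyadic_set R 1 by left; right.
apply/eqP; rewrite eq_le; apply/andP; split; last first.
  (* Exponent [0] is admissible with [C = 1], because a ball contains its centre and so needs at
     least one covering ball. *)
  apply: ereal_sup_ubound; exists 0 => //; split=> // d0 _; exists 1 => // d r r0 rd _.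
  apply: le_ereal_inf_tmp => _ [x Fx <-]; rewrite powRr0 mulr1.
  apply: covering_number_ge1; exists x; split=> //.
  by apply/in_closed_ball; rewrite ?subrr ?normr0 ?(ltW (lt_trans r0 rd)) ?(lt_trans r0 rd).
apply: ge_ereal_sup => _ [s [s0 H] <-]; rewrite lee_fin leNgt; apply/negP => {}s0.
(* At radius [1/4] the point [1] is isolated, so the infimum is at most [1] at every scale. The
   ratio [u = d / r] is chosen so that [C * u ^ s = C + 1 > 1]. *)
have [C C0 {}H] := H (4^-1) ltac:(lra).
pose u : R := (1 + C^-1) `^ s^-1.
have C1 : 1 < 1 + C^-1 by rewrite ltrDl invr_gt0.
have u1 : 1 < u.
  rewrite -(congr1 (@^~ s^-1) (powR1 R)).
  by apply: gt0_ltr_powR; rewrite ?invr_gt0 ?nnegrE ?ltW// (lt_trans ltr01).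
have us : u `^ s = 1 + C^-1 by rewrite /u -powRrM mulVf ?gt_eqF// powRr1//; lra.
have u0 : 0 < u by lra.
have r0 : 0 < 4^-1 / u by rewrite divr_gt0.
have := H (4^-1) (4^-1 / u) r0.
rewrite ltr_pdivrMr// ltr_pMr// => /(_ u1 (lexx _)).
have -> : 4^-1 / (4^-1 / u) = u by rewrite invf_div mulrC divfK// invr_eq0.
apply/negP; rewrite -ltNge us mulrDr mulr1 mulfV ?gt_eqF//.
apply: (@le_lt_trans _ _ 1%:E); last by rewrite lte_fin; lra.
apply: (le_trans (ereal_inf_lbound _)); first by exists 1.
by apply: covering_isolated => //; lra.
Qed.

(** * Failure of equi-homogeneity *)

Lemma covering_at0_ge (R : realType) (n k : nat) (r : R) :
  0 < r -> r < 2 ^- (n + k).+1 ->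
  (k%:R%:E <= covering_number (closed_ball (0 : R)%R (2 ^- n) `&` dyadic_set R) r)%E.
Proof.
move=> r0 rk; apply: covering_number_ge => s sA As.
(* Each of these [k] points satisfies [2 * r < 2 ^- m], so it is isolated at scale [r] and only a
   ball centred at it can cover it. *)
have self m : (n <= m < n + k)%N -> 2 ^- m \in s.
  move=> /andP[nm mk].
  have Fm : dyadic_set R (2 ^- m) by apply/dyadic_setP; right; exists m.
  have [] := As (2 ^- m).
    split=> //; apply/in_closed_ball; first exact: exp2V_gt0.
    by rewrite sub0r normrN gtr0_norm ?exp2V_gt0// exp2V_le.
  move=> c cs /(in_closed_ball _ _ r0); rewrite distrC => mc.
  rewrite -(dyadic_set_isolated Fm (sA _ cs).2 _ mc)//.
  rewrite exp2VS ltr_pM2l//; apply: lt_le_trans rk _.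
  by rewrite exp2V_le ltnS ltnW.
pose pts := [seq (2 : R) ^- m | m <- iota n k].
have upts : uniq pts.
  rewrite map_inj_uniq ?iota_uniq// => a b ab.
  by apply/eqP; rewrite eqn_leq -!(exp2V_le R) ab lexx.
have -> : k = #|` [fset y in pts]%fset|.
  by rewrite card_fseq undup_id// size_map size_iota.
apply: fsubset_leq_card; apply/fsubsetP => y.
by rewrite inE => /mapP[m]; rewrite mem_iota => /self ms ->.
Qed.

Lemma not_equi_homogeneous_dyadic_set (R : realType) :
  ~ equi_homogeneous (dyadic_set R).
Proof.
have F1 : dyadic_set R 1 by left; right.
have F0 : dyadic_set R 0 by left; left.
move=> /(_ 1 ltr01) [M [c1 [c2 [M1 c10 c20 H]]]].
(* With [d = 2 ^- n <= (4 * c1)^-1], the radius [c1 * d] is at most [1/4], so the point [1] is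
   isolated in its ball and the right-hand side is at most [M]. *)
have c0 : 0 < (4 * c1)^-1 by rewrite invr_gt0 mulr_gt0.
have [n nc] := exp2V_small c0.
(* More than [M] balls are forced around [0]; the exponent [n + k + 2] puts [r] strictly below the
   threshold [2 ^- (n + k + 1)] of [covering_at0_ge]. *)
pose k := Num.bound M.
have Mk : M < k%:R by rewrite archi_boundP//; lra.
pose r : R := 2 ^- (n + k).+2.
have r0 : 0 < r := exp2V_gt0 R _.
have := H (2 ^- n) r r0.
rewrite exp2V_lt invf_le1 ?exprn_gt0// exprn_ege1 ?ler1n//.
rewrite ltnS -addnS leq_addr => /(_ isT isT).
apply/negP; rewrite -ltNge.
apply: (@le_lt_trans _ _ M%:E).
  rewrite -[leRHS]mule1; apply: lee_wpmul2l; first by rewrite lee_fin; lra.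
  apply: (le_trans (ereal_inf_lbound _)); first by exists 1.
  apply: covering_isolated; rewrite ?mulr_gt0 ?exp2V_gt0//.
  apply: (@le_lt_trans _ _ (2 * (c1 * (4 * c1)^-1))).
    by rewrite ler_pM2l// ler_pM2l.
  by rewrite invfM [c1 * _]mulrC divfK ?gt_eqF//; lra.
apply: (@lt_le_trans _ _ k%:R%:E); first by rewrite lte_fin.
apply: (@le_trans _ _ (covering_number (closed_ball (0 : R)%R (2 ^- n) `&` dyadic_set R) r)).
  by apply: covering_at0_ge; rewrite // exp2V_lt.
by apply: ereal_sup_ubound; exists 0.
Qed.

Theorem proposition3p7 (R : realType) :
  assouad_dim (dyadic_set R) = 0%E /\
  lower_assouad_dim (dyadic_set R) = 0%E /\
  ~ equi_homogeneous (dyadic_set R).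
Proof.
split; first exact: assouad_dim_dyadic_set.
by split; [exact: lower_assouad_dim_dyadic_set|exact: not_equi_homogeneous_dyadic_set].
Qed.
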